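(* Let $1\le r\le n$. A non-zero $r$-vector $B\in\mathbb{G}_n^r$ is an $r$-blade if and only if both of the following conditions are satisfied: (i) $B^2 = B\cdot B$; (ii) $BvB\in\mathbb{G}_n^1$ for every vector $v\in\mathbb{G}_n^1$ of the form $v=e_K\cdot B$, where $e_K$ is any coordinate $(r-1)$-blade in $\mathbb{G}_n^{r-1}$.
   Context: $\mathbb{G}_n$ is the geometric (Clifford) algebra of Euclidean space $\mathbb{R}^n$ with standard orthonormal basis $e_1,\dots,e_n$: it is the associative unital real algebra generated by $e_1,\dots,e_n$ subject to $e_i^2=1$ and $e_ie_j=-e_je_i$ for $i\ne j$. Juxtaposition (as in $B^2$ and $BvB$) denotes the geometric (Clifford) product. For a sequence $J=(j_1,\dots,j_k)$ of distinct indices in $\{1,\dots,n\}$, $e_J=e_{j_1}e_{j_2}\cdots e_{j_k}$ is called a coordinate $k$-blade ($e_\emptyset=1$). $\mathbb{G}_n^k$ denotes the linear span of the coordinate $k$-blades; its elements are called $k$-vectors, and $\mathbb{G}_n^1=\mathbb{R}^n$. $\langle X\rangle_k$ denotes the projection of $X\in\mathbb{G}_n$ onto $\mathbb{G}_n^k$. For $A\in\mathbb{G}_n^p$ and $C\in\mathbb{G}_n^q$, the inner product is $A\cdot C=\langle AC\rangle_{|p-q|}$ (so $B\cdot B=\langle B^2\rangle_0$ is a scalar) and the outer product is $A\wedge C=\langle AC\rangle_{p+q}$. An $r$-blade is a non-zero $r$-vector that can be written as an outer product $v_1\wedge\cdots\wedge v_r$ of $r$ vectors $v_i\in\mathbb{R}^n$.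 *)

(* Defs.v *)
From HB Require Import structures.
From mathcomp Require Import all_boot all_order all_algebra.
From mathcomp Require Import reals.

Set Implicit Arguments.
Unset Strict Implicit.
Unset Printing Implicit Defensive.

Import GRing.Theory.
Local Open Scope ring_scope.

Definition symdiff n (A B : {set 'I_n}) : {set 'I_n} := (A :\: B) :|: (B :\: A).

(* Moving the factors of e_B past those of e_A into increasing order takes this
   many transpositions of distinct anticommuting generators, so that
   e_A e_B = (-1) ^ inversions A B e_(symdiff A B) once e_i^2 = 1 is used. *)
Definition inversions n (A B : {set 'I_n}) : nat :=
  \sum_(i in A) \sum_(j in B) (j < i)%N.

Lemma in_symdiff n (A B : {set 'I_n}) i :
  (i \in symdiff A B) = (i \in A) (+) (i \in B).
Proof. by rewrite !inE; case: (i \in A); case: (i \in B). Qed.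

Lemma symdiffA n : associative (@symdiff n).
Proof. by move=> A B C; apply/setP=> i; rewrite !in_symdiff addbA. Qed.

Lemma symdiff0s n : left_id set0 (@symdiff n).
Proof. by move=> A; apply/setP=> i; rewrite in_symdiff inE. Qed.

Lemma symdiffs0 n : right_id set0 (@symdiff n).
Proof. by move=> A; apply/setP=> i; rewrite in_symdiff inE addbF. Qed.

Lemma inversions0s n (B : {set 'I_n}) : inversions set0 B = 0%N.
Proof. exact: big_set0. Qed.

Lemma inversionss0 n (A : {set 'I_n}) : inversions A set0 = 0%N.
Proof. by rewrite /inversions big1 // => i _; exact: big_set0. Qed.

Lemma odd_sum_symdiff n (A B : {set 'I_n}) (F : 'I_n -> nat) :
  odd (\sum_(i in symdiff A B) F i) =
  odd (\sum_(i in A) F i) (+) odd (\sum_(i in B) F i).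
Proof.
rewrite -oddD big_mkcond [X in (X + _)%N]big_mkcond [X in (_ + X)%N]big_mkcond.
rewrite -big_split /=.
rewrite !(big_morph odd oddD (erefl (odd 0))) big_mkcond.
apply: eq_bigr => i _; rewrite in_symdiff oddD.
by case: (i \in A); case: (i \in B) => //=; rewrite ?addbF ?addbb.
Qed.

Lemma odd_inversions_symdiffl n (A B C : {set 'I_n}) :
  odd (inversions (symdiff A B) C) =
  odd (inversions A C) (+) odd (inversions B C).
Proof. exact: odd_sum_symdiff. Qed.

Lemma odd_inversions_symdiffr n (A B C : {set 'I_n}) :
  odd (inversions A (symdiff B C)) =
  odd (inversions A B) (+) odd (inversions A C).
Proof.
rewrite /inversions -oddD -big_split /= !(big_morph odd oddD (erefl (odd 0))).
by apply: eq_bigr => i _; rewrite odd_sum_symdiff oddD.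
Qed.

(* The Clifford algebra, through its standard basis: the coordinate of X on
   e_A = e_(a_1) ... e_(a_k), for A = {a_1 < ... < a_k}, is X A. That this is the
   algebra generated by e_1, ..., e_n with the relations e_i^2 = 1 and
   e_i e_j = - e_j e_i is [gen_sqr], [gen_anticomm] and [clifford_generated]:
   such an algebra is spanned by the 2 ^ n products e_A, which are free here. *)
Definition clifford (R : fieldType) (n : nat) : Type := {ffun {set 'I_n} -> R}.
HB.instance Definition _ (R : fieldType) n :=
  Vector.copy (clifford R n) {ffun {set 'I_n} -> R^o}.

Definition basis_blade {R : fieldType} {n} (A : {set 'I_n}) : clifford R n :=
  [ffun S => (S == A)%:R].

(* Locked so that unification does not see it as a sum. *)
HB.lock Definition clifford_mul (R : fieldType) n (X Y : clifford R n) : clifford R n :=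
  \sum_(A : {set 'I_n}) \sum_(B : {set 'I_n})
    ((-1) ^+ inversions A B * X A * Y B) *: basis_blade (symdiff A B).
Arguments clifford_mul {R n} X Y.

Section CliffordAlgebra.
Variables (R : fieldType) (n : nat).
Implicit Types (A B C S : {set 'I_n}) (X Y Z : clifford R n).

Lemma blade_expand X : X = \sum_(A : {set 'I_n}) X A *: basis_blade A.
Proof.
apply/ffunP=> S; rewrite sum_ffunE (bigD1 S) //= big1 => [|A neAS].
  by rewrite !ffunE eqxx addr0 -[RHS]/(_ * 1) mulr1.
by rewrite !ffunE eq_sym (negPf neAS) scaler0.
Qed.

Fact clifford_mulDl : left_distributive (@clifford_mul R n) +%R.
Proof.
move=> X Y Z; rewrite clifford_mul.unlock -big_split; apply: eq_bigr => A _.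
rewrite -big_split; apply: eq_bigr => B _ /=.
by rewrite !ffunE mulrDr mulrDl scalerDl.
Qed.

Fact clifford_mulDr : right_distributive (@clifford_mul R n) +%R.
Proof.
move=> X Y Z; rewrite clifford_mul.unlock -big_split; apply: eq_bigr => A _.
rewrite -big_split; apply: eq_bigr => B _ /=.
by rewrite !ffunE mulrDr scalerDl.
Qed.

Fact clifford_scaleAl (a : R) X Y :
  a *: clifford_mul X Y = clifford_mul (a *: X) Y.
Proof.
rewrite clifford_mul.unlock scaler_sumr; apply: eq_bigr => A _.
rewrite scaler_sumr; apply: eq_bigr => B _ /=.
by rewrite scalerA !ffunE !mulrA [a * _]mulrC.
Qed.

Fact clifford_scaleAr (a : R) X Y :
  a *: clifford_mul X Y = clifford_mul X (a *: Y).
Proof.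
rewrite clifford_mul.unlock scaler_sumr; apply: eq_bigr => A _.
rewrite scaler_sumr; apply: eq_bigr => B _ /=.
by rewrite scalerA !ffunE [a * _]mulrC -!mulrA [Y B * _]mulrC.
Qed.

Fact clifford_mul_suml I r (P : pred I) (F : I -> clifford R n) Y :
  clifford_mul (\sum_(i <- r | P i) F i) Y =
  \sum_(i <- r | P i) clifford_mul (F i) Y.
Proof.
have mul0 : clifford_mul 0 Y = 0.
  by rewrite -[X in clifford_mul X](scale0r 0) -clifford_scaleAl scale0r.
by apply: (big_morph (clifford_mul^~ Y)) => // X Z; apply: clifford_mulDl.
Qed.

Fact clifford_mul_sumr I r (P : pred I) (F : I -> clifford R n) X :
  clifford_mul X (\sum_(i <- r | P i) F i) =
  \sum_(i <- r | P i) clifford_mul X (F i).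
Proof.
have mul0 : clifford_mul X 0 = 0.
  by rewrite -[Y in clifford_mul X Y](scale0r 0) -clifford_scaleAr scale0r.
by apply: (big_morph (clifford_mul X)) => // Y Z; apply: clifford_mulDr.
Qed.

Fact clifford_mul_blade A B :
  clifford_mul (basis_blade A) (basis_blade B) =
  (-1) ^+ inversions A B *: basis_blade (symdiff A B) :> clifford R n.
Proof.
rewrite clifford_mul.unlock (bigD1 A) //= [X in _ + X]big1 => [|A' neA]; last first.
  by apply: big1 => B' _; rewrite !ffunE (negPf neA) mulr0 mul0r scale0r.
rewrite addr0 (bigD1 B) //= big1 => [|B' neB].
  by rewrite !ffunE !eqxx !mulr1 addr0.
by rewrite !ffunE (negPf neB) mulr0 scale0r.
Qed.

Fact clifford_mulA : associative (@clifford_mul R n).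
Proof.
move=> X Y Z; rewrite [X]blade_expand !clifford_mul_suml; apply: eq_bigr => A _.
rewrite -!clifford_scaleAl; congr (_ *: _).
rewrite [Y]blade_expand clifford_mul_sumr !clifford_mul_suml clifford_mul_sumr.
apply: eq_bigr => B _.
rewrite -!(clifford_scaleAr, clifford_scaleAl); congr (_ *: _).
rewrite [Z]blade_expand !clifford_mul_sumr; apply: eq_bigr => C _.
rewrite -!clifford_scaleAr; congr (_ *: _).
rewrite !clifford_mul_blade -clifford_scaleAr -clifford_scaleAl.
rewrite !clifford_mul_blade !scalerA symdiffA.
congr (_ *: _); rewrite -!exprD -signr_odd -[RHS]signr_odd !oddD.
rewrite odd_inversions_symdiffl odd_inversions_symdiffr.
by do 3!case: (odd (inversions _ _)).
Qed.

Fact clifford_mul1 : left_id (basis_blade set0) (@clifford_mul R n).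
Proof.
move=> X; rewrite [X]blade_expand clifford_mul_sumr; apply: eq_bigr => A _.
by rewrite -clifford_scaleAr clifford_mul_blade inversions0s scale1r symdiff0s.
Qed.

Fact clifford_mulr1 : right_id (basis_blade set0) (@clifford_mul R n).
Proof.
move=> X; rewrite [X]blade_expand clifford_mul_suml; apply: eq_bigr => A _.
by rewrite -clifford_scaleAl clifford_mul_blade inversionss0 scale1r symdiffs0.
Qed.

Fact clifford_one_neq0 : basis_blade set0 != 0 :> clifford R n.
Proof.
by apply/eqP=> /ffunP/(_ set0)/eqP; rewrite !ffunE eqxx oner_eq0.
Qed.

HB.instance Definition _ := GRing.Zmodule_isNzRing.Build (clifford R n)
  clifford_mulA clifford_mul1 clifford_mulr1 clifford_mulDl clifford_mulDr clifford_one_neq0.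
HB.instance Definition _ := GRing.Lmodule_isLalgebra.Build R (clifford R n) clifford_scaleAl.
HB.instance Definition _ := GRing.Lalgebra_isAlgebra.Build R (clifford R n) clifford_scaleAr.

End CliffordAlgebra.

Definition gen {R : fieldType} {n} (i : 'I_n) : clifford R n := basis_blade [set i].

Definition coord_blade {R : fieldType} {n} (J : seq 'I_n) : clifford R n :=
  \prod_(j <- J) gen j.

Definition coord_blades (R : fieldType) (n k : nat) : seq (clifford R n) :=
  [seq coord_blade J | J : k.-tuple 'I_n <- enum {: k.-tuple 'I_n} & uniq J].

Definition kvectors (R : fieldType) (n k : nat) : {vspace clifford R n} :=
  <<coord_blades R n k>>%VS.

Definition grade_part {R : fieldType} {n} (k : nat) (X : clifford R n) : clifford R n :=
  [ffun A : {set 'I_n} => if #|A| == k then X A else 0].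

(* The products of homogeneous multivectors, extended bilinearly; see
   [inner_kvectors] and [outer_kvectors] for the formulas on k-vectors. *)
Definition inner {R : fieldType} {n} (X Y : clifford R n) : clifford R n :=
  \sum_(p < n.+1) \sum_(q < n.+1)
    grade_part `|p - q|%N (grade_part p X * grade_part q Y).

Definition outer {R : fieldType} {n} (X Y : clifford R n) : clifford R n :=
  \sum_(p < n.+1) \sum_(q < n.+1)
    grade_part (p + q)%N (grade_part p X * grade_part q Y).

Definition is_blade {R : fieldType} {n} (r : nat) (B : clifford R n) : Prop :=
  [/\ B \in kvectors R n r, B != 0 &
      exists v : 'I_r -> clifford R n,
        (forall i, v i \in kvectors R n 1) /\ B = \big[outer/1]_(i < r) v i].

Section CliffordTheory.
Variables (R : fieldType) (n : nat).
Implicit Types (A B : {set 'I_n}) (X Y : clifford R n).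

Lemma basis_bladeM A B :
  basis_blade A * basis_blade B =
  (-1) ^+ inversions A B *: basis_blade (symdiff A B) :> clifford R n.
Proof. exact: clifford_mul_blade. Qed.

Lemma inversions1 (i j : 'I_n) : inversions [set i] [set j] = (j < i)%N.
Proof. by rewrite /inversions !big_set1. Qed.

Lemma gen_sqr (i : 'I_n) : gen i * gen i = 1 :> clifford R n.
Proof.
rewrite basis_bladeM inversions1 ltnn scale1r; congr basis_blade.
by apply/setP=> k; rewrite in_symdiff addbb inE.
Qed.

Lemma gen_anticomm (i j : 'I_n) :
  i != j -> gen i * gen j = - (gen j * gen i) :> clifford R n.
Proof.
move=> neq_ij; rewrite !basis_bladeM !inversions1.
have -> : symdiff [set j] [set i] = symdiff [set i] [set j].
  by apply/setP=> k; rewrite !in_symdiff addbC.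
by case: ltngtP neq_ij => // [_|_|/val_inj->]; rewrite ?eqxx // scaleN1r scale1r ?opprK.
Qed.

Lemma gen_blade (i : 'I_n) A : i \notin A ->
  gen i * basis_blade A =
  (-1) ^+ inversions [set i] A *: basis_blade (i |: A) :> clifford R n.
Proof.
move=> iA; rewrite basis_bladeM; congr (_ *: basis_blade _).
apply/setP=> k; rewrite in_symdiff !inE; case: eqP => [->|//].
by rewrite (negPf iA).
Qed.

Lemma coord_blade_uniq (J : seq 'I_n) : uniq J ->
  exists s : nat, coord_blade J = (-1) ^+ s *: basis_blade [set j in J] :> clifford R n.
Proof.
elim: J => [_|j J IH /= /andP[jJ /IH[s eJ]]].
  by exists 0%N; rewrite /coord_blade big_nil scale1r set_nil.
rewrite /coord_blade big_cons -/(coord_blade J) eJ -scalerAr gen_blade ?inE //.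
by rewrite scalerA -exprD set_cons; eexists.
Qed.

Lemma coord_blade_sorted (J : seq 'I_n) : sorted ltn (map val J) ->
  coord_blade J = basis_blade [set j in J] :> clifford R n.
Proof.
elim: J => [_|j J IH]; first by rewrite /coord_blade big_nil set_nil.
rewrite [map _ _]/= [sorted _ _]/= (path_sortedE ltn_trans) => /andP[/allP jJ /IH eJ].
have jJ' k : k \in J -> (j < k)%N by move=> kJ; apply/jJ/map_f.
have njJ : j \notin J by apply/negP=> /jJ'; rewrite ltnn.
rewrite /coord_blade big_cons -/(coord_blade J) eJ gen_blade ?inE //.
rewrite /inversions big_set1 big1 => [|k]; first by rewrite scale1r set_cons.
by rewrite inE => /jJ' jk; rewrite ltnNge ltnW.
Qed.

Lemma basis_bladeE A : basis_blade A = coord_blade (enum A) :> clifford R n.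
Proof.
rewrite coord_blade_sorted; last first.
  rewrite sorted_map /enum_mem -enumT sorted_filter //.
    by move=> i j k; exact: ltn_trans.
  by rewrite -sorted_map val_enum_ord iota_ltn_sorted.
by congr basis_blade; apply/setP=> k; rewrite inE mem_enum.
Qed.

Lemma clifford_generated X : X = \sum_(A : {set 'I_n}) X A *: coord_blade (enum A).
Proof. by rewrite [LHS]blade_expand; apply: eq_bigr => A _; rewrite basis_bladeE. Qed.

Fact grade_part_is_linear k : linear (@grade_part R n k).
Proof.
move=> a X Y; apply/ffunP=> A; rewrite !ffunE.
by case: ifP => // _; rewrite scaler0 addr0.
Qed.
HB.instance Definition _ k :=
  GRing.isLinear.Build R (clifford R n) (clifford R n) _ (@grade_part R n k)
    (grade_part_is_linear k).

Lemma grade_part_blade k A :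
  grade_part k (basis_blade A) = if #|A| == k then basis_blade A else 0 :> clifford R n.
Proof.
apply/ffunP=> S; rewrite !ffunE; case: (eqVneq S A) => [->|neSA].
  by case: ifP => _; rewrite !ffunE ?eqxx.
by case: ifP; case: ifP; rewrite !ffunE ?(negPf neSA).
Qed.

Lemma kvectorsP k X : reflect (grade_part k X = X) (X \in kvectors R n k).
Proof.
apply: (iffP idP) => [XP|<-].
  rewrite (coord_span (X := in_tuple _) XP) linear_sum; apply: eq_bigr => i _.
  rewrite linearZ; congr (_ *: _).
  have /mapP[J] := mem_nth 0 (ltn_ord i); rewrite mem_filter => /andP[Ju _] /= ->.
  have [s ->] := coord_blade_uniq Ju; rewrite linearZ_LR/= grade_part_blade.
  by rewrite cardsE (card_uniqP Ju) size_tuple eqxx.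
rewrite [X]blade_expand linear_sum; apply: memv_suml => A _.
rewrite linearZ_LR/= memvZ // grade_part_blade; case: eqP => [cA|_]; last exact: mem0v.
have szA : size (enum A) == k by rewrite -cardE cA.
rewrite basis_bladeE memv_span //; apply/mapP; exists (Tuple szA) => //.
by rewrite mem_filter mem_enum enum_uniq.
Qed.

Lemma grade_part_kvectors k p X : X \in kvectors R n p ->
  grade_part k X = if k == p then X else 0.
Proof.
move=> /kvectorsP Xp; case: eqP => [->//|/eqP nkp]; rewrite -Xp.
apply/ffunP=> A; rewrite !ffunE; case: eqP => // ->; by rewrite (negPf nkp).
Qed.

Lemma kvectors_large k X : (n < k)%N -> X \in kvectors R n k -> X = 0.
Proof.
move=> nk /kvectorsP <-; apply/ffunP=> A; rewrite !ffunE; case: eqP => // cA.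
by have := max_card A; rewrite card_ord cA leqNgt nk.
Qed.

Let bilinear_grade (g : nat -> nat -> nat) p q X Y :
  X \in kvectors R n p -> Y \in kvectors R n q ->
  \sum_(p' < n.+1) \sum_(q' < n.+1)
    grade_part (g p' q') (grade_part p' X * grade_part q' Y)
  = grade_part (g p q) (X * Y).
Proof.
move=> Xp Yq; have [pn|np] := ltnP p n.+1; last first.
  rewrite (kvectors_large np Xp) mul0r linear0 big1 // => i _.
  by rewrite big1 // => j _; rewrite linear0 mul0r linear0.
have [qn|nq] := ltnP q n.+1; last first.
  rewrite (kvectors_large nq Yq) mulr0 linear0 big1 // => i _.
  by rewrite big1 // => j _; rewrite linear0 mulr0 linear0.
rewrite (bigD1 (Ordinal pn)) //= [X in _ + X]big1 => [|i nip]; last first.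
  rewrite big1 // => j _; rewrite (grade_part_kvectors i Xp).
  by rewrite -[_ == p]/(i == Ordinal pn) (negPf nip) mul0r linear0.
rewrite addr0 (bigD1 (Ordinal qn)) //= big1 => [|j njq]; last first.
  rewrite (grade_part_kvectors j Yq).
  by rewrite -[_ == q]/(j == Ordinal qn) (negPf njq) mulr0 linear0.
by rewrite addr0 (grade_part_kvectors _ Xp) (grade_part_kvectors _ Yq) !eqxx.
Qed.

Lemma inner_kvectors p q X Y :
  X \in kvectors R n p -> Y \in kvectors R n q ->
  inner X Y = grade_part `|p - q|%N (X * Y).
Proof. exact: (@bilinear_grade (fun p q => `|p - q|%N)). Qed.

Lemma outer_kvectors p q X Y :
  X \in kvectors R n p -> Y \in kvectors R n q ->
  outer X Y = grade_part (p + q)%N (X * Y).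
Proof. exact: (@bilinear_grade addn). Qed.

End CliffordTheory.

(* Main.v *)
Require Import Defs.
From mathcomp Require Import all_boot all_order all_algebra.
From mathcomp Require Import reals.
From mathcomp Require Import ring.

Set Implicit Arguments.
Unset Strict Implicit.
Unset Printing Implicit Defensive.

Import Order.TTheory GRing.Theory Num.Theory.
Local Open Scope ring_scope.

(** Everything rests on one computation. For a vector u and a k-vector X, the
    product u X has parts of grades k + 1 and k - 1 only, and they are half of
    u X + (-1)^k X u and half of u X - (-1)^k X u [vector_mul_kvector]. So a
    vector that commutes with X up to the sign (-1)^k raises the grade of X by
    one, and a vector that commutes up to the opposite sign lowers it; the
    latter means u /\ X = 0. Orthogonality of vectors is anticommutation.

    A blade satisfies (i) and (ii). By Gram-Schmidt [gram_schmidt_outer], an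
    outer product of vectors is a geometric product w_1 ... w_r of anticommuting
    vectors. Moving factors past each other, the square of this product is
    the scalar +- w_1^2 ... w_r^2, and v is sent by the sandwich to
    +- w_1 (... (w_r v w_r) ...) w_1, a vector since each w v w is one.

    Conversely, let B^2 = l, which is a non-zero scalar by definiteness of
    the scalar product. Let v = e_K . B be such that B v B is a vector. Then
    the vectors u = B v B + (-1)^r l v and u' = (-1)^r l v - B v B add up to
    a multiple of v, and u . B = 0 while u' /\ B = 0. The first relation makes
    u orthogonal to every e_K . B, hence to v, and both together make u
    orthogonal to u'. So u is orthogonal to itself and vanishes, which says that
    v /\ B = 0 [vector_annihilates].

    Pick A with a non-zero coordinate B_A. The r vectors e_(A - a) . B,
    for a in A, are linearly independent, as each is the only one with
    a component along its e_a [free_contractions]. Orthogonalize them into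
    w_1, ..., w_r, with product W. Each w_i still satisfies w_i /\ B = 0, so each
    factor of W lowers the grade by one, and W B is a scalar. Since W^2 is
    a non-zero scalar too, B is a multiple of W, which is an outer product
    [free_annihilators_blade]. *)

(** * Coordinates of products *)

(** Each element j of A other than i counts once: in the first term if j < i,
    and in the second if i < j. *)
Lemma inversions_set1 n (i : 'I_n) (A : {set 'I_n}) :
  (inversions [set i] A + inversions A [set i] + (i \in A) = #|A|)%N.
Proof.
rewrite /inversions big_set1; under [X in (_ + X + _)%N]eq_bigr do rewrite big_set1.
rewrite -big_split -sum1_card /=; have [iA|niA] := boolP (i \in A); last first.
  rewrite addn0; apply: eq_bigr => j jA; have := memPn niA j jA.
  by rewrite -val_eqE /=; case: ltngtP.
rewrite (bigD1 i) //= [RHS](bigD1 i) //= ltnn add0n addn1 add1n; congr _.+1.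
by apply: eq_bigr => j /andP[_]; rewrite -val_eqE /=; case: ltngtP.
Qed.

(** The sign of the square of e_A depends on the cardinality of A alone; this
    is what makes the scalar part of X^2 definite on k-vectors. *)
Lemma inversions_self n (A : {set 'I_n}) : inversions A A = 'C(#|A|, 2).
Proof.
have eA : (inversions A A + inversions A A + #|A| = #|A| * #|A|)%N.
  rewrite -sum_nat_const -(eq_bigr _ (fun i _ => inversions_set1 i A)).
  rewrite !big_split /=; congr (_ + _ + _)%N.
  - by apply: eq_bigr => i _; rewrite /inversions big_set1.
  - rewrite /inversions exchange_big; apply: eq_bigr => i _.
    by apply: eq_bigr => j _; rewrite big_set1.
  by rewrite -sum1_card; apply: eq_bigr => i ->.
apply: double_inj; rewrite bin2 -addnn; apply: (@addIn #|A|); rewrite eA.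
case: #|A| => // k; rewrite halfK oddM /= andNb subn0.
by rewrite [RHS]addnC -[X in (X + _)%N]muln1 -mulnDr add1n.
Qed.

Lemma symdiffss n (A : {set 'I_n}) : symdiff A A = set0.
Proof. by apply/setP=> i; rewrite in_symdiff addbb inE. Qed.

Section CliffordField.
Variables (R : fieldType) (n : nat).
Implicit Types (A B T : {set 'I_n}) (X Y u v w : clifford R n).

Lemma clifford_mul_coord X Y T :
  (X * Y) T =
  \sum_(A : {set 'I_n})
    X A * ((-1) ^+ inversions A (symdiff A T) * Y (symdiff A T)).
Proof.
rewrite [X in X * Y]blade_expand mulr_suml sum_ffunE; apply: eq_bigr => A _.
rewrite -scalerAl [Y in LHS]blade_expand mulr_sumr ffunE; congr (_ * _).
rewrite sum_ffunE (bigD1 (symdiff A T)) //= big1 => [|S neS].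
  rewrite -scalerAr basis_bladeM symdiffA symdiffss symdiff0s scalerA addr0.
  by rewrite !ffunE eqxx [LHS]mulr1 mulrC.
rewrite -scalerAr basis_bladeM !ffunE; case: eqP => [eT|_]; last first.
  by rewrite !scaler0.
by case/eqP: neS; rewrite eT symdiffA symdiffss symdiff0s.
Qed.

Lemma basis_bladeM_coord A Y T :
  (basis_blade A * Y) T = (-1) ^+ inversions A (symdiff A T) * Y (symdiff A T).
Proof.
rewrite clifford_mul_coord (bigD1 A) //= big1 => [|S neS].
  by rewrite ffunE eqxx mul1r addr0.
by rewrite ffunE (negPf neS) mul0r.
Qed.

Lemma scalar_part_mul X Y :
  (X * Y) set0 = \sum_(A : {set 'I_n}) (-1) ^+ 'C(#|A|, 2) * (X A * Y A).
Proof.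
rewrite clifford_mul_coord; apply: eq_bigr => A _.
by rewrite symdiffs0 inversions_self mulrCA.
Qed.

Lemma kvectors_coord0 k X A : X \in kvectors R n k -> #|A| != k -> X A = 0.
Proof. by move/kvectorsP <- => /negPf nA; rewrite ffunE nA. Qed.

Lemma basis_blade_kvectors A : basis_blade A \in kvectors R n #|A|.
Proof. by apply/kvectorsP; rewrite grade_part_blade eqxx. Qed.

Lemma grade_part_in k X : grade_part k X \in kvectors R n k.
Proof. by apply/kvectorsP/ffunP=> A; rewrite !ffunE; case: (#|A| == k). Qed.

Lemma kvectors_expand k X : X \in kvectors R n k ->
  X = \sum_(A : {set 'I_n} | #|A| == k) X A *: basis_blade A.
Proof.
move=> Xk; rewrite [LHS]blade_expand [RHS]big_mkcond; apply: eq_bigr => A _.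
by case: ifPn => // /(kvectors_coord0 Xk) ->; rewrite scale0r.
Qed.

Lemma scalar_expand X : X \in kvectors R n 0 -> X = (X set0)%:A.
Proof.
move/kvectors_expand=> eX; rewrite [LHS]eX (big_pred1 set0) // => A.
by rewrite cards_eq0.
Qed.

(** e_i anticommutes with each factor of e_A except e_i itself. *)
Lemma blade_gen A i :
  basis_blade A * gen i =
  (-1) ^+ (#|A| + (i \in A)) *: (gen i * basis_blade A) :> clifford R n.
Proof.
rewrite !basis_bladeM scalerA -exprD -(inversions_set1 i A).
have -> : symdiff A [set i] = symdiff [set i] A.
  by apply/setP=> k; rewrite !in_symdiff addbC.
congr (_ *: _); rewrite -signr_odd -[RHS]signr_odd !oddD.
by case: (odd _); case: (odd _); case: (i \in A).
Qed.

Let symdiff1_card i A :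
  #|symdiff [set i] A| = if i \in A then #|A|.-1 else #|A|.+1.
Proof.
case: ifPn => iA.
  rewrite (cardsD1 i A) iA; apply: eq_card => j; rewrite in_symdiff !inE.
  by case: eqP => [->|]; rewrite ?iA.
have -> : symdiff [set i] A = i |: A.
  by apply/setP=> j; rewrite in_symdiff !inE; case: eqP => [->|]; rewrite ?(negPf iA).
by rewrite cardsU1 iA.
Qed.

(** Both claims are bilinear, and for u = e_i and X = e_A one of the two
    combinations vanishes by [blade_gen], according to whether e_i is a factor
    of e_A; the other is twice the blade e_i e_A, whose grade is then known. For
    k = 0 the second combination is zero, which the truncated k.-1 covers. *)
Lemma vector_mul_kvector k u X : u \in kvectors R n 1 -> X \in kvectors R n k ->
  u * X + (-1) ^+ k *: (X * u) \in kvectors R n k.+1 /\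
  u * X - (-1) ^+ k *: (X * u) \in kvectors R n k.-1.
Proof.
move=> /kvectors_expand-> /kvectors_expand->.
rewrite mulr_suml mulr_sumr scaler_sumr -big_split -sumrB /=.
suff H A : #|A| == 1%N ->
  let Y := \sum_(S : {set 'I_n} | #|S| == k) X S *: basis_blade S in
  (u A *: basis_blade A) * Y + (-1) ^+ k *: (Y * (u A *: basis_blade A))
     \in kvectors R n k.+1 /\
  (u A *: basis_blade A) * Y - (-1) ^+ k *: (Y * (u A *: basis_blade A))
     \in kvectors R n k.-1.
  by split; apply: rpred_sum => A /H[].
move=> /cards1P[i ->] /=.
rewrite -!scalerAl -!scalerAr !scalerA ![_ * u _]mulrC -!scalerA -scalerDr -scalerBr.
rewrite mulr_suml mulr_sumr scaler_sumr -big_split -sumrB /=.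
suff H (S : {set 'I_n}) : #|S| == k ->
  gen i * (X S *: basis_blade S) + (-1) ^+ k *: ((X S *: basis_blade S) * gen i)
     \in kvectors R n k.+1 /\
  gen i * (X S *: basis_blade S) - (-1) ^+ k *: ((X S *: basis_blade S) * gen i)
     \in kvectors R n k.-1.
  by split; apply/rpredZ/rpred_sum => S /H[].
move=> /eqP <-; rewrite -!scalerAl -!scalerAr !scalerA ![_ * X _]mulrC -!scalerA.
rewrite -scalerDr -scalerBr blade_gen scalerA -exprD addnA exprD -signr_odd addnn.
rewrite odd_double mul1r; have := basis_blade_kvectors (symdiff [set i] S).
rewrite symdiff1_card basis_bladeM; case: (i \in S) => /= iA.
  by rewrite expr1 scaleN1r opprK subrr scaler0 mem0v !(memvZ, memvD).
by rewrite expr0 scale1r subrr scaler0 mem0v !(memvZ, memvD).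
Qed.

End CliffordField.

(** * Vectors acting on multivectors *)

(** For vectors this is orthogonality. *)
Definition anticommute (R : fieldType) n (X Y : clifford R n) := X * Y == - (Y * X).

Section CliffordReal.
Variables (R : realFieldType) (n : nat).
Implicit Types (A T : {set 'I_n}) (X Y B : clifford R n) (u v w : clifford R n).
Implicit Types (vs ws : seq (clifford R n)).

Let half_double X : X = 2^-1 *: (X + X).
Proof. by rewrite -mulr2n -scaler_nat scalerA mulVf ?scale1r // pnatr_eq0. Qed.

(** The hypothesis says that u is orthogonal to X, that is u . X = 0. *)
Lemma vector_mul_raise k u X : u \in kvectors R n 1 -> X \in kvectors R n k ->
  u * X = (-1) ^+ k *: (X * u) -> u * X \in kvectors R n k.+1.
Proof.
move=> u1 Xk e; have [+ _] := vector_mul_kvector u1 Xk.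
by rewrite -e => h; rewrite [_ * _]half_double memvZ.
Qed.

(** The hypothesis says that u /\ X = 0. *)
Lemma vector_mul_lower k u X : u \in kvectors R n 1 -> X \in kvectors R n k ->
  u * X = (-1) ^+ k.+1 *: (X * u) -> u * X \in kvectors R n k.-1.
Proof.
move=> u1 Xk e; have [_ +] := vector_mul_kvector u1 Xk.
by rewrite -scaleNr -mulN1r -exprS -e => h; rewrite [_ * _]half_double memvZ.
Qed.

Lemma vector_anticomm u v : u \in kvectors R n 1 -> v \in kvectors R n 1 ->
  exists c : R, u * v + v * u = c%:A.
Proof.
move=> u1 v1; have [_] := vector_mul_kvector u1 v1.
by rewrite expr1 scaleN1r opprK => /scalar_expand ->; eexists.
Qed.

Lemma vector_sqr u : u \in kvectors R n 1 -> exists c : R, u * u = c%:A.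
Proof.
move=> u1; have [c e] := vector_anticomm u1 u1.
by exists (2^-1 * c); rewrite [LHS]half_double e scalerA.
Qed.

(** The scalar part of X^2 is, up to a sign common to all k-vectors, the sum of
    the squares of the coordinates of X. *)
Lemma scalar_part_sqr_eq0 k X :
  X \in kvectors R n k -> (X * X) set0 = 0 -> X = 0.
Proof.
move=> Xk; rewrite scalar_part_mul => e.
have /eqP : (-1) ^+ 'C(k, 2) * \sum_(A : {set 'I_n}) X A ^+ 2 = 0.
  rewrite mulr_sumr -[RHS]e; apply: eq_bigr => A _.
  have [->//|nA] := eqVneq #|A| k.
  by rewrite (kvectors_coord0 Xk nA) expr0n !mulr0.
rewrite mulf_eq0 signr_eq0 => /eqP.
move/psumr_eq0P=> h; apply/ffunP=> A; rewrite ffunE; apply/eqP.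
by rewrite -sqrf_eq0 h // => S _; exact: sqr_ge0.
Qed.

(** The conditions u . X = 0 and u /\ X = 0, written as commutation up to a sign,
    define subspaces and so survive orthogonalization. *)
Lemma twisted_span (c : R) X ws u :
  {in ws, forall w, w * X = c *: (X * w)} -> u \in <<ws>>%VS ->
  u * X = c *: (X * u).
Proof.
move=> h uws; rewrite (coord_span (X := in_tuple ws) uws) mulr_suml mulr_sumr.
rewrite scaler_sumr; apply: eq_bigr => i _; rewrite -scalerAl -scalerAr.
by rewrite h ?mem_nth // scalerA mulrC -scalerA.
Qed.

(** * Products of orthogonal vectors *)

Lemma anticommute_prod u ws : all (anticommute u) ws ->
  u * \prod_(w <- ws) w = (-1) ^+ size ws *: ((\prod_(w <- ws) w) * u).
Proof.
elim: ws => [_|w ws IH /= /andP[/eqP uw /IH e]].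
  by rewrite big_nil mulr1 mul1r scale1r.
rewrite !big_cons mulrA uw mulNr -[w * u * _]mulrA e -scalerAr -mulrA exprS.
by rewrite mulN1r scaleNr.
Qed.

(** The factor w commutes with itself, hence one sign fewer than in
    [anticommute_prod]: a factor w of W satisfies w /\ W = 0. *)
Lemma mem_anticommute_prod ws w : pairwise (@anticommute R n) ws -> w \in ws ->
  w * \prod_(x <- ws) x = (-1) ^+ (size ws).+1 *: ((\prod_(x <- ws) x) * w).
Proof.
elim: ws => // a ws IH /= /andP[aws pws]; rewrite inE big_cons.
case: eqP => [-> _|_ /= wws].
  by rewrite {1}(anticommute_prod aws) -scalerAr mulrA 2!exprS mulrA mulrNN !mul1r.
rewrite mulrA; have /eqP := allP aws w wws => /(congr1 -%R); rewrite opprK => <-.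
rewrite mulNr -[a * w * _]mulrA IH // -scalerAr mulrA [in RHS]exprS.
by rewrite mulN1r scaleNr.
Qed.

Lemma anticommute_prod_kvectors ws :
  {subset ws <= kvectors R n 1} -> pairwise (@anticommute R n) ws ->
  \prod_(w <- ws) w \in kvectors R n (size ws).
Proof.
elim: ws => [_ _|a ws IH sws /= /andP[aws pws]].
  by rewrite big_nil; apply/kvectorsP; rewrite grade_part_blade cards0.
rewrite big_cons vector_mul_raise ?anticommute_prod ?sws ?mem_head // IH //.
by move=> w wws; rewrite sws // inE wws orbT.
Qed.

(** Up to the scale - w^2, this is the reflection of v along w. *)
Lemma vector_reflection_kvectors w v :
  w \in kvectors R n 1 -> v \in kvectors R n 1 -> w * v * w \in kvectors R n 1.
Proof.
move=> w1 v1; have [c ec] := vector_anticomm w1 v1; have [q eq] := vector_sqr w1.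
rewrite -[w * v](addrK (v * w)) ec mulrBl mulr_algl -mulrA eq mulr_algr.
by rewrite rpredB ?rpredZ.
Qed.

(** For W = a W', moving the second a across W' gives W v W = +- a (W' v W') a. *)
Lemma anticommute_prod_sandwich ws v :
  {subset ws <= kvectors R n 1} -> pairwise (@anticommute R n) ws ->
  v \in kvectors R n 1 ->
  (\prod_(w <- ws) w) * v * (\prod_(w <- ws) w) \in kvectors R n 1.
Proof.
elim: ws => [_ _|a ws IH sws /= /andP[aws pws]] v1.
  by rewrite big_nil mul1r mulr1.
rewrite big_cons; set W := \prod_(w <- ws) w.
rewrite [X in _ * X](anticommute_prod aws) -scalerAr rpredZ //.
have -> : a * W * v * (W * a) = a * (W * v * W) * a by rewrite !mulrA.
apply: vector_reflection_kvectors; first exact/sws/mem_head.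
by apply: IH => // w wws; rewrite sws // inE wws orbT.
Qed.

Lemma anticommute_prod_sqr ws :
  {subset ws <= kvectors R n 1} -> pairwise (@anticommute R n) ws ->
  exists c : R, (\prod_(w <- ws) w) * (\prod_(w <- ws) w) = c%:A.
Proof.
elim: ws => [_ _|a ws IH sws /= /andP[aws pws]].
  by exists 1; rewrite big_nil mul1r scale1r.
rewrite big_cons; set W := \prod_(w <- ws) w.
have [c ec] : exists c : R, W * W = c%:A.
  by apply: IH => // w wws; rewrite sws // inE wws orbT.
have [q eq] := vector_sqr (sws a (mem_head a ws)).
exists ((-1) ^+ size ws * (q * c)).
rewrite [X in _ * X](anticommute_prod aws) -scalerAr -[RHS]scalerA; congr (_ *: _).
have -> : a * W * (W * a) = a * (W * W) * a by rewrite !mulrA.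
by rewrite ec mulr_algr -scalerAl eq scalerA mulrC.
Qed.

Lemma anticommute_prod_neq0 ws :
  {subset ws <= kvectors R n 1} -> pairwise (@anticommute R n) ws ->
  0 \notin ws -> \prod_(w <- ws) w != 0.
Proof.
elim: ws => [_ _ _|a ws IH sws /= /andP[aws pws]].
  by rewrite big_nil oner_neq0.
rewrite inE eq_sym negb_or big_cons => /andP[a0 ws0].
have a1 := sws a (mem_head a ws); have [q eq] := vector_sqr a1.
apply/eqP => /(congr1 ( *%R a)); rewrite mulrA eq mulr0 mulr_algl => /eqP.
rewrite scaler_eq0 => /orP[/eqP q0|].
  by case/eqP: a0; apply: (scalar_part_sqr_eq0 a1); rewrite eq q0 scale0r ffunE.
by apply/negP; apply: IH => // w wws; rewrite sws // inE wws orbT.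
Qed.

(** The vectors ws may include zeros, since the outer product to be
    orthogonalized may vanish; such a vector is harmless because it
    anticommutes with everything. *)
Lemma orthogonal_projection ws v :
  {subset ws <= kvectors R n 1} -> pairwise (@anticommute R n) ws ->
  v \in kvectors R n 1 ->
  exists2 p, p \in <<ws>>%VS & all (anticommute (v - p)) ws.
Proof.
elim: ws => [_ _ _|a ws IH sws /= /andP[aws pws] v1].
  by exists 0; rewrite ?mem0v.
have sws' : {subset ws <= kvectors R n 1}.
  by move=> w wws; rewrite sws // inE wws orbT.
have [p pws' ap] := IH sws' pws v1.
have a1 := sws a (mem_head a ws); have [q eq] := vector_sqr a1.
have p1 : p \in kvectors R n 1 by apply: subvP pws'; apply/span_subvP.
have [s es] := vector_anticomm (rpredB v1 p1) a1.
(* Since a^2 = q, this multiple of a cancels s = (v - p) a + a (v - p). If q = 0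
   then a = 0, and any coefficient works. *)
exists (p + (s / (2 * q)) *: a).
  rewrite span_cons addrC memv_add ?rpredZ ?memv_line //.
rewrite opprD addrA /anticommute; apply/andP; split.
  rewrite -subr_eq0 opprK mulrBl mulrBr addrACA es -scalerAl -scalerAr eq.
  rewrite -opprD -scalerDl scalerA -scalerBl.
  have [q0|q0] := eqVneq q 0; last first.
    by apply/eqP; rewrite -[RHS](scale0r 1); congr (_ *: _); field; exact/q0.
  have a0 : a = 0.
    by apply: (scalar_part_sqr_eq0 a1); rewrite eq q0 scale0r ffunE.
  by move: es; rewrite a0 mulr0 mul0r addr0 q0 mulr0 subr0 => <-.
apply/allP => w wws; have /eqP e1 := allP ap w wws.
have /eqP e2 := allP aws w wws; apply/eqP.
by rewrite mulrBl mulrBr e1 -scalerAl -scalerAr e2 scalerN -opprD.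
Qed.

(** Subtracting from v its projection p onto the span of ws does not change the
    outer product with W, because p /\ W = 0, and makes it equal to the
    geometric product. *)
Lemma gram_schmidt_outer vs :
  {subset vs <= kvectors R n 1} ->
  exists ws, [/\ size ws = size vs, (<<ws>> = <<vs>>)%VS,
    pairwise (@anticommute R n) ws & \prod_(w <- ws) w = \big[outer/1]_(v <- vs) v].
Proof.
elim: vs => [_|v vs IH svs]; first by exists [::]; rewrite !big_nil.
have svs' : {subset vs <= kvectors R n 1}.
  by move=> w wvs; rewrite svs // inE wvs orbT.
have [ws [sz sp pws prodE]] := IH svs'.
have sws : {subset ws <= kvectors R n 1}.
  by apply/span_subvP; rewrite sp; apply/span_subvP.
have v1 := svs v (mem_head v vs).
have [p pws' ap] := orthogonal_projection sws pws v1.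
have p1 : p \in kvectors R n 1 by apply: subvP pws'; apply/span_subvP.
exists ((v - p) :: ws); split; rewrite /= ?sz ?ap //.
  rewrite !span_cons -sp; apply/eqP; rewrite eqEsubv !subv_add !addvSr !andbT.
  apply/andP; split; apply/subvP => _ /vlineP[c ->]; apply: rpredZ.
    by rewrite memv_add ?rpredN ?memv_line.
  by rewrite -{1}[v](subrK p) memv_add ?memv_line.
rewrite !big_cons -prodE; set W := \prod_(w <- ws) w.
have Wk : W \in kvectors R n (size ws) by exact: anticommute_prod_kvectors.
rewrite (outer_kvectors v1 Wk) add1n -{2}[v](subrK p) [in RHS]mulrDl linearD /=.
have /kvectorsP-> : (v - p) * W \in kvectors R n (size ws).+1.
  by apply: vector_mul_raise; rewrite ?rpredB ?anticommute_prod.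
have pW : p * W \in kvectors R n (size ws).-1.
  apply: vector_mul_lower => //; apply: twisted_span pws' => w.
  exact: mem_anticommute_prod.
rewrite (grade_part_kvectors _ pW); case: eqP; rewrite ?addr0 //.
by case: (size ws) => //= m /eqP; rewrite gtn_eqF.
Qed.

Lemma outer_big_kvectors vs : {subset vs <= kvectors R n 1} ->
  \big[outer/1]_(v <- vs) v \in kvectors R n (size vs).
Proof.
move=> svs; have [ws [sz sp pws <-]] := gram_schmidt_outer svs.
rewrite -sz; apply: anticommute_prod_kvectors => //.
by apply/span_subvP; rewrite sp; apply/span_subvP.
Qed.

(** The Gram-Schmidt family of a free family is free, so none of its members
    is zero and their squares are non-zero scalars. *)
Lemma free_outer_neq0 vs : {subset vs <= kvectors R n 1} -> free vs ->
  \big[outer/1]_(v <- vs) v != 0.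
Proof.
move=> svs fvs; have [ws [sz sp pws <-]] := gram_schmidt_outer svs.
have sws : {subset ws <= kvectors R n 1}.
  by apply/span_subvP; rewrite sp; apply/span_subvP.
apply: anticommute_prod_neq0 => //; apply/negP => ws0.
suff /free_not0/(_ ws0) : free ws by rewrite eqxx.
by rewrite /free sp sz.
Qed.

(** * Blades and their annihilating vectors *)

(** With u and u' as in the proof, u . B = 0 and u' /\ B = 0, and u + u' is
    a multiple of v. So u u' + u' u, a scalar c, anticommutes with B and is 0.
    Moreover u is orthogonal to v: the scalar part of v u is that of E (B u),
    which pairs grade k with grade k + 2. Hence u^2 = 0 and u = 0. *)
Lemma vector_annihilates k B E v (l : R) :
  B \in kvectors R n k.+1 -> B != 0 -> B * B = l%:A -> l != 0 ->
  E \in kvectors R n k -> v = grade_part 1 (E * B) ->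
  B * v * B \in kvectors R n 1 ->
  v * B = (-1) ^+ k.+2 *: (B * v).
Proof.
move=> Bk B0 BB l0 Ek ev.
have v1 : v \in kvectors R n 1 by rewrite ev grade_part_in.
set y := B * v * B => y1; set s : R := (-1) ^+ k.+1.
have ss : s * s = 1 by rewrite -expr2 sqrr_sign.
have yB : y * B = l *: (B * v) by rewrite /y -[LHS]mulrA BB mulr_algr.
have By : B * y = l *: (v * B) by rewrite /y -[B * v * B]mulrA mulrA BB mulr_algl.
pose u := y + (s * l) *: v; pose u' := (s * l) *: v - y.
have u1 : u \in kvectors R n 1 by rewrite rpredD ?rpredZ.
have u'1 : u' \in kvectors R n 1 by rewrite rpredB ?rpredZ.
have Bu : B * u = l *: (v * B + s *: (B * v)).
  by rewrite mulrDr By -scalerAr scalerDr scalerA [s * l]mulrC.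
have uB : u * B = s *: (B * u).
  rewrite Bu mulrDl yB -scalerAl !scalerDr !scalerA.
  by rewrite [s * l]mulrC -[l * s * s]mulrA ss mulr1 addrC.
have u'B : u' * B = - (s *: (B * u')).
  rewrite mulrBl mulrBr yB By -!scalerAl -!scalerAr scalerBr !scalerA mulrA ss.
  by rewrite mul1r opprB.
have [c ec] := vector_anticomm u1 u'1.
have c0 : c = 0.
  have : (u * u' + u' * u) * B = - (B * (u * u' + u' * u)).
    clearbody u u'; rewrite mulrDl mulrDr -[u * u' * B]mulrA -[u' * u * B]mulrA.
    rewrite u'B uB.
    rewrite mulrN -!scalerAr !mulrA u'B uB mulNr -!scalerAl scalerN !scalerA ss.
    by rewrite !scale1r opprD.
  rewrite ec mulr_algl mulr_algr.
  move/eqP; rewrite -addr_eq0 -scalerDl scaler_eq0 (negPf B0) orbF.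
  by rewrite -mulr2n mulrn_eq0 => /eqP.
have vu0 : (v * u) set0 = 0.
  have -> : (v * u) set0 = (E * (B * u)) set0.
    rewrite mulrA !scalar_part_mul ev; apply: eq_bigr => A _; rewrite ffunE.
    by case: eqP => // /eqP /(kvectors_coord0 u1) ->; rewrite !mulr0.
  have Buk : B * u \in kvectors R n k.+2.
    by rewrite Bu rpredZ //; case: (vector_mul_kvector v1 Bk).
  rewrite scalar_part_mul big1 // => A _.
  have [cA|/(kvectors_coord0 Ek) ->] := eqVneq #|A| k; last by rewrite mul0r mulr0.
  by rewrite (kvectors_coord0 Buk) ?mulr0 // cA ltn_eqF // leqnSn.
have uv0 : (u * v) set0 = 0.
  rewrite -vu0 !scalar_part_mul; apply: eq_bigr => A _.
  by rewrite [u A * v A]mulrC.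
have eu' : u' = (s * l) *: v + (s * l) *: v - u.
  by rewrite /u' /u opprD addrACA subrr addr0 addrC.
have u0 : u = 0.
  clearbody u u'; apply: (scalar_part_sqr_eq0 u1).
  have := congr1 (fun X : clifford R n => X set0) ec; rewrite c0 scale0r eu'.
  rewrite mulrBr mulrBl mulrDr mulrDl -!scalerAl -!scalerAr !ffunE uv0 vu0.
  rewrite !scaler0 !add0r => /eqP; rewrite -opprD oppr_eq0 -mulr2n mulrn_eq0.
  by move/eqP.
move: Bu; rewrite u0 mulr0 => /esym/eqP; rewrite scaler_eq0 (negPf l0) /=.
by rewrite addr_eq0 exprS mulN1r scaleNr => /eqP.
Qed.

(** Each factor w satisfies w /\ B = 0, and multiplying by the other
    factors, orthogonal to w, changes the sign of commutation with w exactly in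
    step with the grade. *)
Lemma prod_mul_lower ws B r :
  {subset ws <= kvectors R n 1} -> pairwise (@anticommute R n) ws ->
  B \in kvectors R n r -> (size ws <= r)%N ->
  {in ws, forall w, w * B = (-1) ^+ r.+1 *: (B * w)} ->
  (\prod_(w <- ws) w) * B \in kvectors R n (r - size ws).
Proof.
elim: ws => [_ _ Br _ _|a ws IH sws /= /andP[aws pws] Br ltr wB].
  by rewrite big_nil mul1r subn0.
have {}IH : (\prod_(w <- ws) w) * B \in kvectors R n (r - size ws).
  apply: IH => //; [|exact: ltnW|] => w wws.
    by rewrite sws // inE wws orbT.
  by rewrite wB // inE wws orbT.
rewrite big_cons -mulrA subnS; apply: vector_mul_lower => //.
  exact/sws/mem_head.
rewrite mulrA (anticommute_prod aws) -scalerAl -[_ * a * B]mulrA wB ?mem_head //.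
rewrite -scalerAr scalerA mulrA -exprD; congr (_ *: _).
rewrite -[LHS]signr_odd -[RHS]signr_odd /= addnS /= oddD oddB; last exact: ltnW.
by rewrite addbC.
Qed.

Lemma is_blade_orthogonal r B : is_blade r B ->
  exists ws, [/\ {subset ws <= kvectors R n 1}, pairwise (@anticommute R n) ws &
    B = \prod_(w <- ws) w].
Proof.
case=> _ _ [v [v1 ->]]; rewrite -(big_map v xpredT id).
set vs := map v _; have svs : {subset vs <= kvectors R n 1}.
  by move=> _ /mapP[i _ ->].
have [ws [_ sp pws <-]] := gram_schmidt_outer svs; exists ws; split=> //.
by apply/span_subvP; rewrite sp; apply/span_subvP.
Qed.

(** With W the product of the orthogonalized vectors, [prod_mul_lower] brings
    W B down to grade 0; as W^2 is a non-zero scalar, B is a multiple of W. *)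
Lemma free_annihilators_blade k B vs :
  B \in kvectors R n k.+1 -> B != 0 -> {subset vs <= kvectors R n 1} ->
  free vs -> size vs = k.+1 ->
  {in vs, forall v, v * B = (-1) ^+ k.+2 *: (B * v)} ->
  is_blade k.+1 B.
Proof.
move=> Bk B0 svs fvs szvs vB; split=> //.
have [ws [sz sp pws prodE]] := gram_schmidt_outer svs.
have sws : {subset ws <= kvectors R n 1}.
  by apply/span_subvP; rewrite sp; apply/span_subvP.
have W0 : \prod_(w <- ws) w != 0 by rewrite prodE free_outer_neq0.
have WB : \prod_(w <- ws) w * B \in kvectors R n 0.
  have := @prod_mul_lower ws B k.+1 sws pws Bk; rewrite sz szvs subnn.
  apply=> // w wws; apply: twisted_span vB _; rewrite -sp; exact: memv_span.
have [q WW] := anticommute_prod_sqr sws pws.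
have q0 : q != 0.
  apply: contraNneq W0 => q0; apply/eqP.
  apply: scalar_part_sqr_eq0 (anticommute_prod_kvectors sws pws) _.
  by rewrite WW q0 scale0r ffunE.
set W := \prod_(w <- ws) w in prodE W0 WB WW.
have [c eB] : exists c : R, B = c *: W.
  have [d eWB] : exists d : R, W * B = d%:A.
    by exists ((W * B) set0); exact: scalar_expand.
  exists (q^-1 * d); rewrite -scalerA -[d *: W]mulr_algr -eWB.
  by rewrite mulrA WW mulr_algl scalerA mulVf // scale1r.
case: vs szvs svs prodE {fvs vB sz sp} => // v vs [szvs] svs prodE.
(* The factor c is absorbed by the first vector. *)
pose vs' := c *: v :: vs.
have svs' : {subset vs' <= kvectors R n 1}.
  move=> w; rewrite inE => /predU1P[->|wvs]; first by rewrite rpredZ ?svs ?mem_head.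
  by rewrite svs // inE wvs orbT.
have svs0 : {subset vs <= kvectors R n 1}.
  by move=> w wvs; rewrite svs // inE wvs orbT.
exists (fun i : 'I_k.+1 => nth 0 vs' i); split=> [i|].
  by apply/svs'/mem_nth; rewrite /= szvs.
rewrite -(big_mkord xpredT (nth 0 vs')).
have -> : k.+1 = size vs' by rewrite /= szvs.
rewrite -(big_nth 0 xpredT id) big_cons eB prodE big_cons.
have Y := outer_big_kvectors svs0.
rewrite (outer_kvectors (svs v (mem_head _ _)) Y).
rewrite (outer_kvectors (svs' _ (mem_head _ _)) Y).
by rewrite -scalerAl linearZ.
Qed.

(** * Independent contractions of an r-vector *)

Lemma span_coord0 vs X A :
  {in vs, forall v, v A = 0} -> X \in <<vs>>%VS -> X A = 0.
Proof.
move=> vs0 Xvs; rewrite (coord_span (X := in_tuple vs) Xvs) sum_ffunE big1 // => i _.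
by rewrite ffunE vs0 ?scaler0 // mem_nth.
Qed.

Lemma free_diagonal (I : eqType) (T : I -> {set 'I_n}) (f : I -> clifford R n)
    (s : seq I) :
  uniq s -> {in s &, forall a b, (f a (T b) == 0) = (a != b)} ->
  free [seq f a | a <- s].
Proof.
elim: s => [_ _|a s IH /= /andP[nas us] fT]; first by rewrite nil_free.
rewrite free_cons IH // ?andbT => [|b c bs cs]; last first.
  by rewrite fT // inE ?bs ?cs orbT.
apply/negP => /(@span_coord0 _ _ (T a)) fa0.
have : f a (T a) == 0.
  apply/eqP/fa0 => _ /mapP[b bs ->]; apply/eqP; rewrite fT ?mem_head //.
    by apply: contraNneq nas => <-.
  by rewrite inE bs orbT.
by rewrite fT ?mem_head ?eqxx.
Qed.

(** The coordinate of e_(A - a) . B on e_b is +- the coordinate of B on the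
    symmetric difference of A - a and b. That set is A if b = a, and has
    r - 2 elements if b is another element of A. *)
Lemma free_contractions r B A : B \in kvectors R n r -> B A != 0 ->
  free [seq grade_part 1 (basis_blade (A :\ a) * B) | a <- enum A].
Proof.
move=> Br BA; have cA : #|A| = r.
  by apply/eqP; apply: contraNT BA => /(kvectors_coord0 Br) ->.
apply: (@free_diagonal _ (fun b => [set b])) (enum_uniq _) _ => a b.
rewrite !mem_enum => aA bA.
rewrite ffunE cards1 eqxx basis_bladeM_coord mulf_eq0 signr_eq0 /=.
have [<-|neab] := eqVneq a b.
  have -> : symdiff (A :\ a) [set a] = A.
    apply/setP=> i; rewrite in_symdiff !inE.
    by case: eqP => [->|_] /=; rewrite ?aA ?addbF.
  exact: negPf.
have -> : symdiff (A :\ a) [set b] = A :\ a :\ b.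
  apply/setP=> i; rewrite in_symdiff !inE; have [->|_] /= := eqVneq i b.
    by rewrite bA eq_sym neab.
  by rewrite addbF.
apply/eqP/(kvectors_coord0 Br); rewrite -cA (cardsD1 a A) aA.
by rewrite (cardsD1 b (A :\ a)) !inE bA [b == a]eq_sym neab /= neq_ltn add1n ltnS leqW.
Qed.
End CliffordReal.

(** * The characterization *)

Theorem theorem2 (R : realType) (n r : nat) (hr : (1 <= r <= n)%N)
    (B : clifford R n) (hB : B \in kvectors R n r) (hB0 : B != 0) :
  is_blade r B <->
  (B ^+ 2 = inner B B /\
   (forall v : clifford R n, v \in kvectors R n 1 ->
      (exists K : seq 'I_n,
         [/\ uniq K, size K = r.-1 & v = inner (coord_blade K) B]) ->
      B * v * B \in kvectors R n 1)).
Proof.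
rewrite expr2 (inner_kvectors hB hB) distnn; split.
  case/is_blade_orthogonal => ws [sws pws ->]; split; last first.
    by move=> v v1 _; apply: anticommute_prod_sandwich.
  have [c ->] := anticommute_prod_sqr sws pws; apply/esym/kvectorsP.
  by rewrite rpredZ //; apply/kvectorsP; rewrite grade_part_blade cards0.
case=> BB BvB; case: r hr hB BvB => // k _ Bk BvB.
have {BB} [l BB] : exists l : R, B * B = l%:A.
  by exists ((B * B) set0); apply: scalar_expand; rewrite BB grade_part_in.
have l0 : l != 0.
  apply: contraNneq hB0 => l0; apply/eqP/(scalar_part_sqr_eq0 Bk).
  by rewrite BB l0 scale0r ffunE.
have [A BA] : exists A, B A != 0.
  apply/existsP; apply: contraNT hB0 => /existsPn B0; apply/eqP/ffunP => A.
  by rewrite ffunE; apply/eqP; rewrite -[_ == _]negbK.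
have cA : #|A| = k.+1.
  by apply/eqP; apply: contraNT BA => /(kvectors_coord0 Bk) ->.
pose vs := [seq grade_part 1 (basis_blade (A :\ a) * B) | a <- enum A].
apply: (@free_annihilators_blade _ _ k B vs) => //.
- by move=> _ /mapP[a _ ->]; exact: grade_part_in.
- exact: free_contractions Bk BA.
- by rewrite size_map -cardE.
move=> v /mapP[a]; rewrite mem_enum => aA ->.
have cAa : #|A :\ a| = k by move: cA; rewrite (cardsD1 a A) aA => -[].
have Ek : basis_blade (A :\ a) \in kvectors R n k.
  by rewrite -cAa; exact: basis_blade_kvectors.
apply: (vector_annihilates Bk hB0 BB l0 Ek) => //.
apply: BvB; first exact: grade_part_in.
exists (enum (A :\ a)); rewrite enum_uniq -cardE cAa -basis_bladeE.
by rewrite (inner_kvectors Ek Bk) distnS.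
Qed.
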